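(* Let $\mathbb D\subset\mathbb C$ be the unit disc, let $u\in C^\infty(b\mathbb D)$ be a $C^\infty$ function on the unit circle, and let $h$ and $H$ be the terms in the $h+H$ decomposition of $u$. Then the solution $U$ of the classical Dirichlet problem for harmonic functions on $\mathbb D$ with boundary datum $u$ admits the representation $$U(z)=h(z)+H(1/\bar z),\qquad z\in\mathbb D.$$
   Context: The $h+H$ decomposition of $u\in C^\infty(b\mathbb D)$ is the unique decomposition $u=h+H$ on $b\mathbb D$ where $h$ is holomorphic on $\mathbb D$ and in $C^\infty(\overline{\mathbb D})$, while $H$ is holomorphic on $\mathbb C\setminus\overline{\mathbb D}$, in $C^\infty(\mathbb C\setminus\mathbb D)$, and tends to $0$ at infinity. At $z=0$ the expression $H(1/\bar z)$ is understood as its limit $0$ (removable singularity). The solution of the Dirichlet problem with datum $u$ is the function $U$ continuous on $\overline{\mathbb D}$, harmonic in $\mathbb D$, with $U=u$ on $b\mathbb D$. *)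

(* Defs.v *)
From Stdlib Require Import Reals.
From Coquelicot Require Import Coquelicot.

Open Scope R_scope.

(* Functions on subsets of the plane are total functions on [C]; only their
   values on the relevant subset matter. *)

Definition open_disc (z : C) : Prop := Cmod z < 1.
Definition closed_disc (z : C) : Prop := Cmod z <= 1.
Definition unit_circle (z : C) : Prop := Cmod z = 1.
Definition open_exterior (z : C) : Prop := 1 < Cmod z.
Definition closed_exterior (z : C) : Prop := 1 <= Cmod z.

(* Smoothness on the circle is tested in the local coordinate t |-> e^{it};
   the values of [u] off the circle are irrelevant. *)
Definition smooth_on_circle (u : C -> C) : Prop :=
  forall (n : nat) (t : R),
    ex_derive_n (fun s : R => Re (u (cos s, sin s))) n t /\
    ex_derive_n (fun s : R => Im (u (cos s, sin s))) n t.

Definition of_xy (f : C -> R) (x y : R) : R := f (x, y).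

(* C^infinity on the closure [K] of the open set [Omega]: smooth on [Omega],
   continuous on [K], with every partial derivative extending continuously
   from [Omega] to [K]. *)
Definition smooth_up_to_boundary_R (Omega K : C -> Prop) (f : C -> R) : Prop :=
  continuous_on K f /\
  (forall (n : nat) (z : C), Omega z -> ex_diff_n (of_xy f) n (Re z) (Im z)) /\
  (forall m k : nat, exists g : C -> R,
     continuous_on K g /\
     forall z : C, Omega z ->
       g z = partial_derive m k (of_xy f) (Re z) (Im z)).

Definition smooth_up_to_boundary (Omega K : C -> Prop) (f : C -> C) : Prop :=
  smooth_up_to_boundary_R Omega K (fun z => Re (f z)) /\
  smooth_up_to_boundary_R Omega K (fun z => Im (f z)).

Definition holomorphic_on (Omega : C -> Prop) (f : C -> C) : Prop :=
  forall z : C, Omega z -> @ex_derive C_AbsRing C_NormedModule f z.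

Definition tends_to_0_at_infinity (f : C -> C) : Prop :=
  forall eps : R, 0 < eps ->
    exists M : R, forall z : C, M < Cmod z -> Cmod (f z) < eps.

Record is_hH_decomposition (u h H : C -> C) : Prop := {
  hH_h_holomorphic : holomorphic_on open_disc h;
  hH_h_smooth : smooth_up_to_boundary open_disc closed_disc h;
  hH_H_holomorphic : holomorphic_on open_exterior H;
  hH_H_smooth : smooth_up_to_boundary open_exterior closed_exterior H;
  hH_H_infinity : tends_to_0_at_infinity H;
  hH_sum : forall z : C, unit_circle z -> u z = (h z + H z)%C
}.

Definition laplacian (f : C -> R) (z : C) : R :=
  partial_derive 2 0 (of_xy f) (Re z) (Im z) +
  partial_derive 0 2 (of_xy f) (Re z) (Im z).

Definition harmonic_on_R (Omega : C -> Prop) (f : C -> R) : Prop :=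
  forall z : C, Omega z ->
    ex_diff_n (of_xy f) 2 (Re z) (Im z) /\ laplacian f z = 0.

Definition harmonic_on (Omega : C -> Prop) (f : C -> C) : Prop :=
  harmonic_on_R Omega (fun z => Re (f z)) /\
  harmonic_on_R Omega (fun z => Im (f z)).

Record is_dirichlet_solution (u U : C -> C) : Prop := {
  dirichlet_continuous :
    @continuous_on C_UniformSpace C_UniformSpace closed_disc U;
  dirichlet_harmonic : harmonic_on open_disc U;
  dirichlet_boundary : forall z : C, unit_circle z -> U z = u z
}.

(* [z |-> H (1 / conj z)].  The singularity at 0 is filled in with the limit 0:
   in Coquelicot [1 / 0] is [0], so the bare expression would give the
   meaningless value [H 0] there. *)
Definition reflect (H : C -> C) (z : C) : C :=
  if Ceq_dec z 0 then RtoC 0 else H (1 / Cconj z)%C.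

(* Main.v *)
Require Import Defs.
From Stdlib Require Import Reals Lra Lia List Classical ClassicalEpsilon.
From Coquelicot Require Import Coquelicot.

(** The function [V z = h z + H (1 / conj z)] is itself a solution of the
    Dirichlet problem, up to its behaviour at 0, and such a solution is unique.

    The inversion [z |-> 1 / conj z] fixes the unit circle pointwise, so there [V]
    takes the value [h + H = u].  It exchanges the punctured disc with the
    exterior of the disc, hence [V] is continuous on the closed disc; at 0 this is
    the vanishing of [H] at infinity ([continuous_on_reflect_R]).

    By the Cauchy-Riemann equations the real and imaginary parts of [h] and [H]
    are harmonic ([holomorphic_harmonic]), and harmonicity survives composition
    with the inversion ([is_laplacian_inversion], a direct chain-rule
    computation).  So [V] is harmonic in the punctured disc.

    It remains to see that the real and imaginary parts of [U - V] vanish.  They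
    are continuous on the closed disc, zero on the circle and harmonic except
    perhaps at 0.  Instead of removing the singularity, the maximum principle is
    proved directly on the punctured disc ([max_principle]) with the barrier
    [ln |z|^2 + |z|^2 - 1], whose pole at 0 dominates any bounded function; the
    point 0 is recovered by continuity ([zero_of_harmonic_punctured]). *)

(** * Compactness in the plane *)

Lemma list_argmax (A : Type) (F : A -> R) (l : list A) : l <> nil ->
  exists t, In t l /\ forall s, In s l -> F s <= F t.
Proof.
induction l as [|a l IH]; [easy|intros _].
destruct l as [|b l].
- exists a; split; [now left|]. intros s [->|[]]; lra.
- destruct IH as [t [Ht Hmax]]; [easy|].
  destruct (Rle_dec (F t) (F a)) as [Hle|Hgt].
  + exists a; split; [now left|].
    intros s [->|Hs]; [lra|]. specialize (Hmax s Hs); lra.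
  + exists t; split; [now right|].
    intros s [->|Hs]; [lra|auto].
Qed.

(** If no point of [K] were a maximum, every point of the plane would have a
    neighbourhood on which [f], restricted to [K], stays below its value at some
    point of [K].  Finitely many of these neighbourhoods cover [K]; the
    largest of the corresponding finitely many values is then below itself. *)
Lemma compact_max (K : C -> Prop) (f : C -> R) (M : R) :
  (forall z, K z -> Cmod z <= M) ->
  (forall z : C, ~ K z -> @locally C_UniformSpace z (fun w => ~ K w)) ->
  @continuous_on C_UniformSpace R_UniformSpace K f ->
  (exists z, K z) ->
  exists z, K z /\ forall w, K w -> f w <= f z.
Proof.
intros Hbound Hclosed Hcont [z0 Hz0].
apply NNPP; intros Hno.
assert (Hbetter : forall z : C, exists d : posreal * C, K (snd d) /\
  forall w : C, @ball C_UniformSpace z (fst d) w -> K w -> f w < f (snd d)).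
{ intros z. destruct (classic (K z)) as [Hz | Hz].
  - assert (Hq : exists q, K q /\ f z < f q).
    { apply NNPP; intros Hq; apply Hno; exists z; split; [exact Hz|].
      intros w Hw; apply Rnot_lt_le; intros Hlt; apply Hq; now exists w. }
    destruct Hq as [q [Kq Hq]].
    destruct (Hcont z Hz (fun y => y < f q)) as [d Hd].
    { now apply open_lt. }
    exists (d, q); split; [exact Kq|exact Hd].
  - destruct (Hclosed z Hz) as [d Hd]. exists (d, z0); split; [exact Hz0|].
    intros w Hw Kw; destruct (Hd w Hw Kw). }
set (D := fun z => proj1_sig (constructive_indefinite_description _ (Hbetter z))).
assert (HD : forall z, K (snd (D z)) /\ forall w : C,
   @ball C_UniformSpace z (fst (D z)) w -> K w -> f w < f (snd (D z))).
{ intros z; exact (proj2_sig (constructive_indefinite_description _ (Hbetter z))). }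
pose (pt := fun t : R * (R * unit) => (fst t, fst (snd t)) : C).
apply (compactness_list 2 (-M, (-M, tt)) (M, (M, tt)) (fun t => fst (D (pt t)))).
intros [l Hl].
assert (Hcover : forall z, K z -> exists t, In t l /\ f z < f (snd (D (pt t)))).
{ intros z Kz.
  assert (Hz := Rle_trans _ _ _ (Rmax_Cmod z) (Hbound z Kz)).
  assert (H1 := Rle_trans _ _ _ (Rmax_l _ _) Hz).
  assert (H2 := Rle_trans _ _ _ (Rmax_r _ _) Hz).
  apply Rabs_le_between in H1; apply Rabs_le_between in H2.
  destruct (Hl (fst z, (snd z, tt))) as [t [Ht [_ Hclose]]].
  { simpl; tauto. }
  exists t; split; [exact Ht|]. apply (proj2 (HD _)); [|exact Kz].
  destruct t as [t1 [t2 []]]; destruct z as [x y].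
  destruct Hclose as [Hc1 [Hc2 _]]; split; assumption. }
destruct (list_argmax _ (fun t => f (snd (D (pt t)))) l) as [t [Ht Hmax]].
{ destruct (Hcover z0 Hz0) as [t [Ht _]]; intros ->; destruct Ht. }
destruct (Hcover (snd (D (pt t)))) as [s [Hs Hlt]]; [apply HD|].
specialize (Hmax s Hs); simpl in Hmax; lra.
Qed.

(** * Second derivatives and maxima *)

Definition is_derive2 (f : R -> R) (x l : R) : Prop :=
  exists f' : R -> R, locally x (fun t => is_derive f t (f' t)) /\ is_derive f' x l.

Lemma is_derive2_ext (f g : R -> R) (x l : R) :
  locally x (fun t => f t = g t) -> is_derive2 f x l -> is_derive2 g x l.
Proof.
intros Hfg [f' [H1 H2]]; exists f'; split; [|exact H2].
generalize (filter_and _ _ (locally_locally _ _ Hfg) H1); apply filter_imp.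
intros t [Ht1 Ht2]; exact (is_derive_ext_loc _ _ _ _ Ht1 Ht2).
Qed.

Lemma is_derive2_lin (f g : R -> R) (x k a b : R) :
  is_derive2 f x a -> is_derive2 g x b ->
  is_derive2 (fun t => f t + k * g t) x (a + k * b).
Proof.
intros [f' [Hf Hf']] [g' [Hg Hg']].
exists (fun t => f' t + k * g' t); split.
- generalize (filter_and _ _ Hf Hg); apply filter_imp; intros t [Ht1 Ht2].
  apply (is_derive_plus (V := R_NormedModule)); [exact Ht1|now apply is_derive_scal].
- apply (is_derive_plus (V := R_NormedModule)); [exact Hf'|now apply is_derive_scal].
Qed.

(** At a maximum the first derivative vanishes, so a positive second derivative
    would make the first derivative positive just to the right, and the function
    would increase there. *)
Lemma is_derive2_le_0_of_max (f : R -> R) (x l : R) :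
  is_derive2 f x l -> locally x (fun t => f t <= f x) -> l <= 0.
Proof.
intros [f' [[d1 H1] H2]] [d2 Hmax].
apply Rnot_lt_le; intros Hl.
assert (Hd : is_derive f x (f' x)) by (apply H1, ball_center).
assert (H0 : f' x = 0).
{ apply is_derive_Reals in Hd.
  rewrite <- (deriv_maximum f (x - d2) (x + d2) x (exist _ (f' x) Hd)).
  - reflexivity.
  - generalize (cond_pos d2); lra.
  - generalize (cond_pos d2); lra.
  - intros t Ht1 Ht2; apply Hmax, Rabs_lt_between'; lra. }
apply is_derive_Reals in H2.
destruct (H2 l Hl) as [d3 H3].
set (s := Rmin d1 (Rmin d2 d3) / 2).
assert (Hs : 0 < s /\ s < d1 /\ s < d2 /\ s < d3).
{ unfold s. generalize (cond_pos d1) (cond_pos d2) (cond_pos d3).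
  unfold Rmin; repeat destruct Rle_dec; lra. }
destruct (MVT_cor2 f f' x (x + s)) as [c [Hc1 Hc2]]; [lra| |].
{ intros c Hc; apply is_derive_Reals, H1, Rabs_lt_between'; lra. }
assert (Hle : f (x + s) <= f x) by (apply Hmax, Rabs_lt_between'; lra).
specialize (H3 (c - x)); rewrite H0 in H3.
replace (x + (c - x)) with c in H3 by ring.
assert (H4 : Rabs ((f' c - 0) / (c - x) - l) < l).
{ apply H3; [lra|]. apply Rabs_lt_between; lra. }
apply Rabs_lt_between in H4.
assert (0 < (f' c - 0) / (c - x)) by lra.
assert (0 < f' c).
{ replace (f' c) with ((f' c - 0) / (c - x) * (c - x)) by (field; lra).
  apply Rmult_lt_0_compat; lra. }
assert (0 < f' c * (x + s - x)) by (apply Rmult_lt_0_compat; lra).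
lra.
Qed.

(** Stated line by line because the second-derivative test works on the two
    coordinate lines through the point, and because sums and the barrier below
    are then handled by one-variable calculus. *)
Definition is_laplacian (f : C -> R) (z : C) (L : R) : Prop :=
  exists a b : R,
    is_derive2 (fun t => f (t, Im z)) (Re z) a /\
    is_derive2 (fun t => f (Re z, t)) (Im z) b /\ a + b = L.

Lemma is_laplacian_lin (f g : C -> R) (z : C) (k a b : R) :
  is_laplacian f z a -> is_laplacian g z b ->
  is_laplacian (fun w => f w + k * g w) z (a + k * b).
Proof.
intros [a1 [a2 [Ha1 [Ha2 <-]]]] [b1 [b2 [Hb1 [Hb2 <-]]]].
exists (a1 + k * b1), (a2 + k * b2); repeat split.
- now apply is_derive2_lin.
- now apply is_derive2_lin.
- ring.
Qed.

Lemma locally_line_x (z : C) (P : C -> Prop) :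
  @locally C_UniformSpace z P -> locally (Re z) (fun t => P (t, Im z)).
Proof.
intros [d Hd]; exists d; intros t Ht; apply Hd; split; [exact Ht|apply ball_center].
Qed.

Lemma locally_line_y (z : C) (P : C -> Prop) :
  @locally C_UniformSpace z P -> locally (Im z) (fun t => P (Re z, t)).
Proof.
intros [d Hd]; exists d; intros t Ht; apply Hd; split; [apply ball_center|exact Ht].
Qed.

Lemma is_laplacian_ext (f g : C -> R) (z : C) (L : R) :
  @locally C_UniformSpace z (fun w => f w = g w) ->
  is_laplacian f z L -> is_laplacian g z L.
Proof.
intros Hfg [a [b [Ha [Hb HL]]]]; exists a, b; split; [|split; [|exact HL]].
- revert Ha; apply is_derive2_ext. exact (locally_line_x _ _ Hfg).
- revert Hb; apply is_derive2_ext. exact (locally_line_y _ _ Hfg).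
Qed.

Lemma is_laplacian_le_0_of_max (f : C -> R) (z : C) (L : R) :
  is_laplacian f z L -> @locally C_UniformSpace z (fun w => f w <= f z) -> L <= 0.
Proof.
intros [a [b [Ha [Hb <-]]]] Hmax.
destruct z as [x y].
apply is_derive2_le_0_of_max in Ha; [|exact (locally_line_x _ _ Hmax)].
apply is_derive2_le_0_of_max in Hb; [|exact (locally_line_y _ _ Hmax)].
lra.
Qed.

(** * Topology of the plane through the modulus *)

Lemma im_le_Cmod (c : C) : Rabs (Im c) <= Cmod c.
Proof. exact (Rle_trans _ _ _ (Rmax_r _ _) (Rmax_Cmod c)). Qed.

Lemma continuous_Re (z : C) : @continuous C_UniformSpace R_UniformSpace Re z.
Proof. destruct z as [x y]; exact (continuous_fst x y). Qed.

Lemma continuous_Im (z : C) : @continuous C_UniformSpace R_UniformSpace Im z.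
Proof. destruct z as [x y]; exact (continuous_snd x y). Qed.

Lemma Cmod_sub_le (w z : C) : Rabs (Cmod w - Cmod z) <= Cmod (w - z)%C.
Proof.
apply Rabs_le_between. split.
- generalize (Cmod_triangle (- (w - z)) w). rewrite Cmod_opp.
  replace (- (w - z) + w)%C with z by ring. lra.
- generalize (Cmod_triangle (w - z) z). replace (w - z + z)%C with w by ring. lra.
Qed.

Lemma continuous_Cmod (z : C) : @continuous C_UniformSpace R_UniformSpace Cmod z.
Proof.
apply (filterlim_locally (F := @locally C_UniformSpace z) (U := R_UniformSpace)).
intros eps.
assert (He : 0 < eps / sqrt 2) by (apply Rdiv_lt_0_compat; [apply cond_pos|apply Rlt_sqrt2_0]).
exists (mkposreal _ He); intros w Hw.
generalize (C_NormedModule_mixin_compat2 z w (mkposreal _ He) Hw); simpl; intros H.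
replace (sqrt 2 * (eps / sqrt 2)) with (pos eps) in H
  by (field; apply Rgt_not_eq, Rlt_sqrt2_0).
change (Rabs (Cmod w - Cmod z) < eps).
eapply Rle_lt_trans; [|exact H].
change (minus w z) with (w - z)%C.
apply Cmod_sub_le.
Qed.

Lemma locally_Cmod_gt (r : R) (z : C) :
  r < Cmod z -> @locally C_UniformSpace z (fun w : C => r < Cmod w).
Proof. intros Hz. exact (continuous_Cmod z (fun y => r < y) (open_gt r _ Hz)). Qed.

Lemma locally_Cmod_lt (r : R) (z : C) :
  Cmod z < r -> @locally C_UniformSpace z (fun w : C => Cmod w < r).
Proof. intros Hz. exact (continuous_Cmod z (fun y => y < r) (open_lt r _ Hz)). Qed.

Lemma locally_open_disc (z : C) : open_disc z -> @locally C_UniformSpace z open_disc.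
Proof. exact (locally_Cmod_lt 1 z). Qed.

Lemma locally_open_exterior (z : C) :
  open_exterior z -> @locally C_UniformSpace z open_exterior.
Proof. exact (locally_Cmod_gt 1 z). Qed.

Lemma sqr_add_pos (x y : R) : (x, y) <> (0 : C) -> 0 < x ^ 2 + y ^ 2.
Proof.
intros Hz. apply Cmod_gt_0 in Hz. generalize (pow_lt _ 2 Hz).
rewrite Cmod2_alt; simpl; lra.
Qed.

Lemma locally_neq_0 (z : C) : z <> 0%C -> @locally C_UniformSpace z (fun w : C => w <> 0%C).
Proof.
intros Hz. apply Cmod_gt_0 in Hz.
generalize (locally_Cmod_gt 0 z Hz); apply filter_imp.
intros w Hw; apply Cmod_gt_0, Hw.
Qed.

Lemma continuous_on_lin (K : C -> Prop) (f g : C -> R) (k : R) :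
  @continuous_on C_UniformSpace R_UniformSpace K f ->
  @continuous_on C_UniformSpace R_UniformSpace K g ->
  @continuous_on C_UniformSpace R_UniformSpace K (fun z => f z + k * g z).
Proof.
intros Hf Hg z Hz.
apply (filterlim_comp_2 (G := locally (f z)) (H := locally (k * g z))
  f (fun w => k * g w) Rplus).
- now apply Hf.
- apply filterlim_comp with (locally (g z)); [now apply Hg|].
  apply (filterlim_scal_r (K := R_AbsRing) (V := R_NormedModule)).
- apply (filterlim_plus (K := R_AbsRing) (V := R_NormedModule)).
Qed.

(** * The maximum principle on the punctured disc *)

(** This function vanishes on the unit circle, is negative in the punctured disc,
    tends to minus infinity at 0 and has Laplacian 4 elsewhere.  One small multiple
    of it therefore both turns harmonic functions into strictly subharmonic ones
    and rules out any bad behaviour at the puncture. *)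
Definition barrier (z : C) : R := ln (Cmod z ^ 2) + Cmod z ^ 2 - 1.

Lemma is_laplacian_barrier (z : C) : z <> 0%C -> is_laplacian barrier z 4.
Proof.
intros Hz.
assert (Hn := locally_neq_0 z Hz).
destruct z as [x y].
assert (Hp := sqr_add_pos _ _ Hz).
exists (2 * (y ^ 2 - x ^ 2) / (x ^ 2 + y ^ 2) ^ 2 + 2),
  (2 * (x ^ 2 - y ^ 2) / (x ^ 2 + y ^ 2) ^ 2 + 2); repeat split.
- exists (fun t => 2 * t / (t ^ 2 + y ^ 2) + 2 * t); simpl Re; simpl Im; split.
  + generalize (locally_line_x _ _ Hn); apply filter_imp; intros t Ht.
    apply sqr_add_pos in Ht; simpl in Ht.
    apply is_derive_ext with (fun t => ln (t ^ 2 + y ^ 2) + (t ^ 2 + y ^ 2) - 1).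
    { intros s; unfold barrier; now rewrite Cmod2_alt. }
    auto_derive; [simpl; lra|field; lra].
  + auto_derive; [simpl in *; lra|field; lra].
- exists (fun t => 2 * t / (x ^ 2 + t ^ 2) + 2 * t); simpl Re; simpl Im; split.
  + generalize (locally_line_y _ _ Hn); apply filter_imp; intros t Ht.
    apply sqr_add_pos in Ht; simpl in Ht.
    apply is_derive_ext with (fun t => ln (x ^ 2 + t ^ 2) + (x ^ 2 + t ^ 2) - 1).
    { intros s; unfold barrier; now rewrite Cmod2_alt. }
    auto_derive; [simpl; lra|field; lra].
  + auto_derive; [simpl in *; lra|field; lra].
- simpl; field; simpl in *; lra.
Qed.

Lemma continuous_barrier (z : C) : z <> 0%C ->
  @continuous C_UniformSpace R_UniformSpace barrier z.
Proof.
intros Hz; apply Cmod_gt_0 in Hz.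
apply (continuous_comp (U := C_UniformSpace) Cmod (fun r => ln (r ^ 2) + r ^ 2 - 1));
  [apply continuous_Cmod|].
apply (ex_derive_continuous (V := R_NormedModule)); auto_derive.
simpl; rewrite Rmult_1_r; now apply Rmult_lt_0_compat.
Qed.

(** If [W p > 0], add to [W] so small a multiple of [barrier] that the sum is
    still positive at [p].  The sum is negative near 0 and at most 0 on the unit
    circle, so its maximum over a closed annulus is reached at an interior point,
    where its positive Laplacian contradicts the second-derivative test. *)
Lemma max_principle (W : C -> R) :
  @continuous_on C_UniformSpace R_UniformSpace closed_disc W ->
  (forall z, open_disc z -> z <> 0%C -> is_laplacian W z 0) ->
  (forall z, unit_circle z -> W z <= 0) ->
  forall z, open_disc z -> z <> 0%C -> W z <= 0.
Proof.
unfold open_disc, unit_circle.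
intros Hcont Hlap Hbd p Hp Hp0.
apply Rnot_lt_le; intros HWp.
apply Cmod_gt_0 in Hp0.
destruct (compact_max closed_disc W 1) as [m [Km Hm]].
{ easy. }
{ intros z Hz; generalize (locally_Cmod_gt 1 z (Rnot_le_lt _ _ Hz)).
  apply filter_imp; intros w Hw; exact (Rlt_not_le _ _ Hw). }
{ exact Hcont. }
{ exists p; unfold closed_disc; lra. }
assert (Hp2 : 0 < Cmod p ^ 2 < 1) by (simpl; nra).
assert (HBp : barrier p < 0).
{ unfold barrier. assert (ln (Cmod p ^ 2) < 0); [|lra].
  rewrite <- ln_1; apply ln_increasing; lra. }
set (eps := W p / (- 2 * barrier p)).
assert (Heps : 0 < eps) by (apply Rdiv_lt_0_compat; lra).
set (phi := fun z => W z + eps * barrier z).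
assert (Hphip : 0 < phi p).
{ unfold phi, eps. replace (_ + _) with (W p / 2) by (field; lra). lra. }
set (r := exp (- W m / eps / 2)).
set (K := fun z => r <= Cmod z <= 1).
(* [r] is chosen so that [eps * ln (r ^ 2)] is minus the maximum of [W]. *)
assert (Hsmall : forall z : C, z <> 0%C -> Cmod z <= r -> Cmod z < 1 -> phi z < 0).
{ intros z Hz Hzr Hz1; unfold phi, barrier.
  apply Cmod_gt_0 in Hz.
  assert (W z <= W m) by (apply Hm; unfold closed_disc; lra).
  assert (Hln : ln (Cmod z ^ 2) <= - W m / eps).
  { replace (Cmod z ^ 2) with (Cmod z * Cmod z) by ring. rewrite ln_mult by lra.
    assert (ln (Cmod z) <= - W m / eps / 2); [|lra].
    rewrite <- (ln_exp (- W m / eps / 2)); apply ln_le; [lra|exact Hzr]. }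
  assert (Hlt : ln (Cmod z ^ 2) + Cmod z ^ 2 - 1 < - W m / eps) by (simpl in *; nra).
  apply Rmult_lt_compat_l with (1 := Heps) in Hlt.
  replace (eps * (- W m / eps)) with (- W m) in Hlt by (field; lra). lra. }
assert (HK0 : forall z : C, K z -> z <> 0%C).
{ intros z [Hz _] ->. rewrite Cmod_0 in Hz. generalize (exp_pos (- W m / eps / 2)).
  unfold r in Hz; lra. }
assert (Kp : K p).
{ split; [|lra]. apply Rnot_lt_le; intros Hlt.
  generalize (Hsmall p (proj2 (Cmod_gt_0 p) Hp0)); lra. }
destruct (compact_max K phi 1) as [q [Kq Hq]].
{ now intros z [_ Hz]. }
{ intros z Hz. apply not_and_or in Hz; destruct Hz as [Hz|Hz]; apply Rnot_le_lt in Hz.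
  - generalize (locally_Cmod_lt r z Hz).
    apply filter_imp; intros w Hw [Kw _]; exact (Rlt_not_le _ _ Hw Kw).
  - generalize (locally_Cmod_gt 1 z Hz).
    apply filter_imp; intros w Hw [_ Kw]; exact (Rlt_not_le _ _ Hw Kw). }
{ apply continuous_on_lin.
  - apply continuous_on_subset with closed_disc; [now intros z [_ Hz]|exact Hcont].
  - intros z Hz. intros P HP. apply filter_le_within.
    now apply (continuous_barrier z (HK0 z Hz)). }
{ now exists p. }
assert (Hphiq : 0 < phi q) by (generalize (Hq p Kp); lra).
assert (Hq0 := HK0 q Kq).
assert (Hq1 : Cmod q < 1).
{ destruct Kq as [_ [H1|H1]]; [exact H1|].
  exfalso. generalize (Hbd q H1). unfold phi, barrier in Hphiq; rewrite H1 in Hphiq.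
  replace (1 ^ 2) with 1 in Hphiq by ring. rewrite ln_1 in Hphiq; lra. }
assert (Hqr : r < Cmod q).
{ apply Rnot_le_lt; intros Hle. generalize (Hsmall q Hq0 Hle Hq1); lra. }
assert (H4 := is_laplacian_lin _ _ _ eps _ _ (Hlap q Hq1 Hq0) (is_laplacian_barrier q Hq0)).
apply is_laplacian_le_0_of_max in H4; [lra|].
generalize (filter_and _ _ (locally_Cmod_lt 1 q Hq1)
  (locally_Cmod_gt r q Hqr)).
apply filter_imp; intros w [Hw1 Hw2]. apply Hq; unfold K; lra.
Qed.

(** The maximum principle for [W] and [- W] settles the punctured disc; continuity
    carries the conclusion across the puncture. *)
Lemma zero_of_harmonic_punctured (W : C -> R) :
  @continuous_on C_UniformSpace R_UniformSpace closed_disc W ->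
  (forall z, open_disc z -> z <> 0%C -> is_laplacian W z 0) ->
  (forall z, unit_circle z -> W z = 0) ->
  forall z, open_disc z -> W z = 0.
Proof.
intros Hc Hlap Hbd.
assert (Hpunct : forall z, open_disc z -> z <> 0%C -> W z = 0).
{ intros z Hz Hz0; apply Rle_antisym.
  - apply max_principle; auto. intros w Hw; rewrite (Hbd w Hw); lra.
  - assert (W z + -2 * W z <= 0); [|lra].
    (* [- W] is written as [W - 2 W] so that the lemmas on linear combinations apply. *)
    apply (max_principle (fun w => W w + -2 * W w)); auto.
    + now apply continuous_on_lin.
    + intros w Hw Hw0. replace 0 with (0 + -2 * 0) by ring.
      now apply is_laplacian_lin; apply Hlap.
    + intros w Hw; rewrite (Hbd w Hw); lra. }
intros z Hz. destruct (Ceq_dec z 0) as [->|Hz0]; [|now apply Hpunct].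
apply NNPP; intros HW.
destruct (Hc (RtoC 0) (Rlt_le _ _ Hz) _ (open_neq 0 (W 0%C) HW)) as [d Hd].
(* a nonzero point of the disc at which [W] would have to be nonzero *)
set (r := Rmin d 1 / 2).
assert (Hr : 0 < r /\ r < d /\ r < 1).
{ unfold r; generalize (cond_pos d); unfold Rmin; destruct Rle_dec; lra. }
assert (Hmod : Cmod (RtoC r) = r) by (rewrite Cmod_R; apply Rabs_pos_eq; lra).
apply (Hd (RtoC r)).
- split; apply Rabs_lt_between'; simpl; lra.
- unfold closed_disc; lra.
- apply Hpunct; [unfold open_disc; lra|]. apply Cmod_gt_0; lra.
Qed.

(** * Partial derivatives and the chain rule *)

Definition partial_x (F : R -> R -> R) (x y : R) : R := Derive (fun t => F t y) x.
Definition partial_y (F : R -> R -> R) (x y : R) : R := Derive (fun t => F x t) y.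

Lemma differentiable_of_ex_diff (F : R -> R -> R) (x y : R) :
  locally_2d (ex_diff_n F 2) x y ->
  differentiable_pt_lim F x y (partial_x F x y) (partial_y F x y).
Proof.
intros HF.
assert (H0 := locally_2d_singleton _ _ _ HF).
destruct H0 as [_ [_ [Hy [[Hc _] _]]]].
apply filterdiff_differentiable_pt_lim.
apply (is_derive_filterdiff F x y (partial_x F) (partial_y F x y)).
- apply locally_2d_locally in HF. revert HF; apply filter_imp.
  intros [u v] [_ [Hu _]]; apply Derive_correct, Hu.
- apply Derive_correct, Hy.
- apply continuity_2d_pt_filterlim in Hc. exact Hc.
Qed.

Lemma is_derive_curve (F : R -> R -> R) (a b : R -> R) (t a' b' : R) :
  locally_2d (ex_diff_n F 2) (a t) (b t) ->
  is_derive a t a' -> is_derive b t b' ->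
  is_derive (fun s => F (a s) (b s)) t (partial_x F (a t) (b t) * a' + partial_y F (a t) (b t) * b').
Proof.
intros HF Ha Hb.
apply is_derive_Reals, derivable_pt_lim_comp_2d.
- now apply differentiable_of_ex_diff.
- now apply is_derive_Reals.
- now apply is_derive_Reals.
Qed.

Lemma locally_2d_ex_diff_partial_x F n x y :
  locally_2d (ex_diff_n F (S n)) x y -> locally_2d (ex_diff_n (partial_x F) n) x y.
Proof.
apply locally_2d_impl, locally_2d_forall; intros u v; apply ex_diff_n_deriv_aux1.
Qed.

Lemma locally_2d_ex_diff_partial_y F n x y :
  locally_2d (ex_diff_n F (S n)) x y -> locally_2d (ex_diff_n (partial_y F) n) x y.
Proof.
apply locally_2d_impl, locally_2d_forall; intros u v; apply ex_diff_n_deriv_aux2.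
Qed.

Lemma partial_x_y_comm (F : R -> R -> R) (x y : R) :
  locally_2d (ex_diff_n F 2) x y -> partial_x (partial_y F) x y = partial_y (partial_x F) x y.
Proof.
intros HF; apply Schwarz.
- revert HF; apply locally_2d_impl, locally_2d_forall; intros u v.
  intros [_ [H1 [H2 [[_ [_ [H4 _]]] [_ [H5 _]]]]]]; tauto.
- destruct (locally_2d_singleton _ _ _ HF) as [_ [_ [_ [_ [_ [_ [_ [[H _] _]]]]]]]].
  exact H.
- destruct (locally_2d_singleton _ _ _ HF) as [_ [_ [_ [[_ [_ [_ [_ [H _]]]]] _]]]].
  exact H.
Qed.

(** Differentiate once, then apply the first-order chain rule to each partial
    derivative; Schwarz's theorem merges the two mixed terms. *)
Lemma is_derive2_curve (F : R -> R -> R) (a b a' b' : R -> R) (x a2 b2 : R) :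
  locally_2d (ex_diff_n F 3) (a x) (b x) ->
  locally x (fun t => is_derive a t (a' t)) -> is_derive a' x a2 ->
  locally x (fun t => is_derive b t (b' t)) -> is_derive b' x b2 ->
  is_derive2 (fun t => F (a t) (b t)) x
    (partial_x (partial_x F) (a x) (b x) * a' x ^ 2 + 2 * partial_x (partial_y F) (a x) (b x) * (a' x * b' x)
     + partial_y (partial_y F) (a x) (b x) * b' x ^ 2
     + partial_x F (a x) (b x) * a2 + partial_y F (a x) (b x) * b2).
Proof.
intros HF Ha Ha2 Hb Hb2.
exists (fun t => partial_x F (a t) (b t) * a' t + partial_y F (a t) (b t) * b' t).
assert (HF2 : locally_2d (ex_diff_n F 2) (a x) (b x)).
{ revert HF; apply locally_2d_impl, locally_2d_forall; intros u v.
  apply ex_diff_n_m; lia. }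
assert (Hax := locally_singleton _ _ Ha). assert (Hbx := locally_singleton _ _ Hb).
split.
- assert (Hab : locally x (fun t => locally_2d (ex_diff_n F 2) (a t) (b t))).
  { destruct HF2 as [d Hd].
    assert (Ca : continuous a x) by (apply (ex_derive_continuous (V := R_NormedModule)); eexists; exact Hax).
    assert (Cb : continuous b x) by (apply (ex_derive_continuous (V := R_NormedModule)); eexists; exact Hbx).
    assert (Da : locally x (fun t => locally (a t) (ball (a x) d)))
      by exact (Ca _ (locally_locally _ _ (locally_ball (a x) d))).
    assert (Db : locally x (fun t => locally (b t) (ball (b x) d)))
      by exact (Cb _ (locally_locally _ _ (locally_ball (b x) d))).
    generalize (filter_and _ _ Da Db).
    apply filter_imp; intros t [[e1 H1] [e2 H2]].
    exists (mkposreal _ (Rmin_stable_in_posreal e1 e2)); simpl; intros u v Hu Hv.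
    apply Hd.
    - apply H1. eapply Rlt_le_trans; [exact Hu|apply Rmin_l].
    - apply H2. eapply Rlt_le_trans; [exact Hv|apply Rmin_r]. }
  generalize (filter_and _ _ Hab (filter_and _ _ Ha Hb)); apply filter_imp.
  intros t [H1 [H2 H3]]; now apply is_derive_curve.
- assert (H1 := is_derive_curve (partial_x F) a b x _ _ (locally_2d_ex_diff_partial_x _ _ _ _ HF) Hax Hbx).
  assert (H2 := is_derive_curve (partial_y F) a b x _ _ (locally_2d_ex_diff_partial_y _ _ _ _ HF) Hax Hbx).
  evar_last.
  { apply (is_derive_plus (V := R_NormedModule)).
    - apply (is_derive_mult _ a'); [exact H1|exact Ha2|exact Rmult_comm].
    - apply (is_derive_mult _ b'); [exact H2|exact Hb2|exact Rmult_comm]. }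
  rewrite (partial_x_y_comm F _ _ HF2). cbv -[Rplus Rmult partial_x partial_y IZR]. ring.
Qed.

(** * The inversion in the unit circle *)

(** This is [z / |z|^2], the reflection of the plane in the unit circle. *)
Definition inversion (z : C) : C := (1 / Cconj z)%C.

Lemma inversion_xy (x y : R) :
  inversion (x, y) = (x / (x ^ 2 + y ^ 2), y / (x ^ 2 + y ^ 2)).
Proof.
unfold inversion, Cdiv, Cinv, Cconj, Cmult; simpl.
apply injective_projections; simpl; replace (- y * (- y * 1)) with (y * (y * 1)) by ring;
unfold Rdiv; ring.
Qed.

Lemma Cmod_inversion (z : C) : z <> 0%C -> Cmod (inversion z) = / Cmod z.
Proof.
intros Hz. assert (Hc : Cconj z <> 0%C).
{ apply Cmod_gt_0; rewrite Cmod_conj; now apply Cmod_gt_0. }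
unfold inversion. rewrite Cmod_div by exact Hc.
rewrite Cmod_1, Cmod_conj; unfold Rdiv; ring.
Qed.

Lemma inversion_unit (z : C) : unit_circle z -> inversion z = z.
Proof.
intros Hz. assert (H := Cmod2_alt z). rewrite Hz in H.
destruct z as [x y]; simpl in H; rewrite inversion_xy.
apply injective_projections; simpl; rewrite <- H; field.
Qed.

Lemma continuous_inversion (z : C) : z <> 0%C ->
  @continuous C_UniformSpace C_UniformSpace inversion z.
Proof.
intros Hz; apply Cmod_gt_0 in Hz.
assert (Hc : @continuous C_UniformSpace R_UniformSpace (fun w => / Cmod w ^ 2) z).
{ apply (continuous_comp (U := C_UniformSpace) Cmod (fun r => / r ^ 2));
    [apply continuous_Cmod|].
  apply (ex_derive_continuous (V := R_NormedModule)); auto_derive; simpl; nra. }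
assert (Hpair : @continuous C_UniformSpace C_UniformSpace
  (fun w => (Re w * / Cmod w ^ 2, Im w * / Cmod w ^ 2)) z).
{ apply (continuous_comp_2 (U := C_UniformSpace) (V := R_UniformSpace) (W := R_UniformSpace)
    (X := C_UniformSpace) (fun w => Re w * / Cmod w ^ 2) (fun w => Im w * / Cmod w ^ 2) pair).
  - apply (continuous_mult (K := R_AbsRing)); [|exact Hc].
    apply continuous_Re.
  - apply (continuous_mult (K := R_AbsRing)); [|exact Hc].
    apply continuous_Im.
  - apply (continuous_ext (fun q => q)); [now intros [a b]|apply continuous_id]. }
revert Hpair; apply continuous_ext; intros [x y].
now rewrite inversion_xy, Cmod2_alt.
Qed.

(** The inversion is conformal up to orientation and its components are harmonic.
    In the Laplacian of the composite, the two pure second derivatives of [f] thus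
    get the same factor [1 / |z|^4], and the coefficients of the mixed and of the
    first derivatives cancel. *)
Lemma is_laplacian_inversion (f : C -> R) (z : C) : z <> 0%C ->
  locally_2d (ex_diff_n (of_xy f) 3) (Re (inversion z)) (Im (inversion z)) ->
  laplacian f (inversion z) = 0 ->
  is_laplacian (fun w => f (inversion w)) z 0.
Proof.
intros Hz Hdiff Hlap.
assert (Hn := locally_neq_0 z Hz).
change (partial_x (partial_x (of_xy f)) (Re (inversion z)) (Im (inversion z)) +
  partial_y (partial_y (of_xy f)) (Re (inversion z)) (Im (inversion z)) = 0) in Hlap.
destruct z as [x y].
rewrite inversion_xy in Hdiff, Hlap; simpl Re in *; simpl Im in *.
assert (Hp := sqr_add_pos _ _ Hz).
set (fxx := partial_x (partial_x (of_xy f)) _ _) in Hlap.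
set (fyy := partial_y (partial_y (of_xy f)) _ _) in Hlap.
set (fxy := partial_x (partial_y (of_xy f)) (x / (x ^ 2 + y ^ 2)) (y / (x ^ 2 + y ^ 2))).
set (fx := partial_x (of_xy f) (x / (x ^ 2 + y ^ 2)) (y / (x ^ 2 + y ^ 2))).
set (fy := partial_y (of_xy f) (x / (x ^ 2 + y ^ 2)) (y / (x ^ 2 + y ^ 2))).
(* the chain-rule values along the horizontal and the vertical line through [z],
   with the derivatives of [x / |z|^2] and [y / |z|^2] *)
exists (fxx * ((y ^ 2 - x ^ 2) / (x ^ 2 + y ^ 2) ^ 2) ^ 2
     + 2 * fxy * ((y ^ 2 - x ^ 2) / (x ^ 2 + y ^ 2) ^ 2 * (- 2 * x * y / (x ^ 2 + y ^ 2) ^ 2))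
     + fyy * (- 2 * x * y / (x ^ 2 + y ^ 2) ^ 2) ^ 2
     + fx * (2 * x * (x ^ 2 - 3 * y ^ 2) / (x ^ 2 + y ^ 2) ^ 3)
     + fy * (2 * y * (3 * x ^ 2 - y ^ 2) / (x ^ 2 + y ^ 2) ^ 3)),
  (fxx * (- 2 * x * y / (x ^ 2 + y ^ 2) ^ 2) ^ 2
     + 2 * fxy * ((- 2 * x * y / (x ^ 2 + y ^ 2) ^ 2) * ((x ^ 2 - y ^ 2) / (x ^ 2 + y ^ 2) ^ 2))
     + fyy * ((x ^ 2 - y ^ 2) / (x ^ 2 + y ^ 2) ^ 2) ^ 2
     + fx * (2 * x * (3 * y ^ 2 - x ^ 2) / (x ^ 2 + y ^ 2) ^ 3)
     + fy * (2 * y * (y ^ 2 - 3 * x ^ 2) / (x ^ 2 + y ^ 2) ^ 3)).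
assert (Hx := locally_line_x _ _ Hn). assert (Hy := locally_line_y _ _ Hn).
simpl Re in *; simpl Im in *.
split; [|split].
- apply (is_derive2_curve (of_xy f)
    (fun t => t / (t ^ 2 + y ^ 2)) (fun t => y / (t ^ 2 + y ^ 2))
    (fun t => (y ^ 2 - t ^ 2) / (t ^ 2 + y ^ 2) ^ 2)
    (fun t => - 2 * t * y / (t ^ 2 + y ^ 2) ^ 2) x
    (2 * x * (x ^ 2 - 3 * y ^ 2) / (x ^ 2 + y ^ 2) ^ 3)
    (2 * y * (3 * x ^ 2 - y ^ 2) / (x ^ 2 + y ^ 2) ^ 3)) in Hdiff.
  + destruct Hdiff as [f' [H1 H2]]; exists f'; split; [|exact H2].
    revert H1; apply filter_imp; intros t; apply is_derive_ext; intros s.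
    now rewrite inversion_xy.
  + revert Hx; apply filter_imp; intros t Ht; apply sqr_add_pos in Ht; simpl in Ht.
    auto_derive; [simpl; lra|field; lra].
  + auto_derive; [simpl in *; nra|field; lra].
  + revert Hx; apply filter_imp; intros t Ht; apply sqr_add_pos in Ht; simpl in Ht.
    auto_derive; [simpl; lra|field; lra].
  + auto_derive; [simpl in *; nra|field; lra].
- apply (is_derive2_curve (of_xy f)
    (fun t => x / (x ^ 2 + t ^ 2)) (fun t => t / (x ^ 2 + t ^ 2))
    (fun t => - 2 * x * t / (x ^ 2 + t ^ 2) ^ 2)
    (fun t => (x ^ 2 - t ^ 2) / (x ^ 2 + t ^ 2) ^ 2) y
    (2 * x * (3 * y ^ 2 - x ^ 2) / (x ^ 2 + y ^ 2) ^ 3)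
    (2 * y * (y ^ 2 - 3 * x ^ 2) / (x ^ 2 + y ^ 2) ^ 3)) in Hdiff.
  + destruct Hdiff as [f' [H1 H2]]; exists f'; split; [|exact H2].
    revert H1; apply filter_imp; intros t; apply is_derive_ext; intros s.
    now rewrite inversion_xy.
  + revert Hy; apply filter_imp; intros t Ht; apply sqr_add_pos in Ht; simpl in Ht.
    auto_derive; [simpl; lra|field; lra].
  + auto_derive; [simpl in *; nra|field; lra].
  + revert Hy; apply filter_imp; intros t Ht; apply sqr_add_pos in Ht; simpl in Ht.
    auto_derive; [simpl; lra|field; lra].
  + auto_derive; [simpl in *; nra|field; lra].
- (* only here does the harmonicity of [f] enter *)
  replace fyy with (- fxx) by lra. field; lra.
Qed.

(** * Holomorphic functions have harmonic components *)

Lemma C_derive_estimate (f : C -> C) (z l : C) (eps : posreal) :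
  @is_derive C_AbsRing C_NormedModule f z l ->
  exists d : posreal, forall w : C, Cmod (w - z) < d ->
    Cmod (f w - f z - (w - z) * l)%C <= eps * Cmod (w - z).
Proof.
intros [_ H].
destruct (H z (fun P HP => HP) eps) as [d Hd].
now exists d; intros w Hw; apply Hd.
Qed.

(** Restricting to the line through [z] of direction [v] turns the complex
    derivative [l] into the real derivative [v * l].  The functional [L] stands for
    [Re] or [Im], and [p] is a parametrization of the line: keeping it abstract
    allows it to be a coordinate line as the partial derivatives present it. *)
Lemma is_derive_line (f : C -> C) (z l v : C) (L : C -> R) (p : R -> C) (t : R) :
  @is_derive C_AbsRing C_NormedModule f z l ->
  (forall (a b c : C) (s : R), L (a - b - s * c)%C = L a - L b - s * L c) ->
  (forall a, Rabs (L a) <= Cmod a) ->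
  Cmod v = 1 -> (forall s : R, p s = z + (s - t)%R * v)%C ->
  is_derive (fun s => L (f (p s))) t (L (v * l)%C).
Proof.
intros Hf HL HL1 Hv Hp.
apply is_derive_Reals; intros eps Heps.
assert (He : 0 < eps / 2) by lra.
destruct (C_derive_estimate f z l (mkposreal _ He) Hf) as [d Hd].
exists d; intros s Hs Hsd; simpl in Hd.
assert (Hpt : p t = z).
{ rewrite Hp. replace (t - t) with 0 by ring. ring. }
assert (Hps : (p (t + s)%R - z = s * v)%C).
{ rewrite Hp. replace (t + s - t) with s by ring. ring. }
assert (HC : Cmod (p (t + s)%R - z) = Rabs s).
{ rewrite Hps, Cmod_mult, Hv, Cmod_R; ring. }
specialize (Hd (p (t + s))). rewrite HC, Hps in Hd. specialize (Hd Hsd).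
rewrite <- Cmult_assoc in Hd.
apply (Rle_trans _ _ _ (HL1 _)) in Hd. rewrite HL in Hd.
rewrite Hpt.
replace ((L (f (p (t + s))) - L (f z)) / s - L (v * l)%C)
  with ((L (f (p (t + s))) - L (f z) - s * L (v * l)%C) / s) by (field; exact Hs).
unfold Rdiv at 1; rewrite Rabs_mult, Rabs_inv.
assert (Hs' := Rabs_pos_lt _ Hs).
apply Rmult_lt_reg_r with (Rabs s); [exact Hs'|].
rewrite Rmult_assoc, Rinv_l by lra. nra.
Qed.

Lemma cauchy_riemann (f : C -> C) (x y : R) (l : C) :
  @is_derive C_AbsRing C_NormedModule f (x, y) l ->
  let u := of_xy (fun z => Re (f z)) in
  let v := of_xy (fun z => Im (f z)) in
  partial_x u x y = partial_y v x y /\ partial_y u x y = - partial_x v x y.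
Proof.
intros Hf u v.
assert (HRe : forall (a b c : C) (s : R), Re (a - b - s * c)%C = Re a - Re b - s * Re c).
{ intros a b c s; unfold Re, Im, Cminus, Copp, Cplus, Cmult; simpl; ring. }
assert (HIm : forall (a b c : C) (s : R), Im (a - b - s * c)%C = Im a - Im b - s * Im c).
{ intros a b c s; unfold Re, Im, Cminus, Copp, Cplus, Cmult; simpl; ring. }
assert (Hh : forall s : R, ((s, y) = (x, y) + (s - x)%R * 1)%C).
{ intros s; apply injective_projections; simpl; ring. }
assert (Hv : forall s : R, ((x, s) = (x, y) + (s - y)%R * Ci)%C).
{ intros s; apply injective_projections; simpl; ring. }
assert (E1 : partial_x u x y = Re (1 * l)%C).
{ apply is_derive_unique.
  exact (is_derive_line f _ l _ Re _ x Hf HRe re_le_Cmod Cmod_1 Hh). }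
assert (E2 : partial_x v x y = Im (1 * l)%C).
{ apply is_derive_unique.
  exact (is_derive_line f _ l _ Im _ x Hf HIm im_le_Cmod Cmod_1 Hh). }
assert (E3 : partial_y u x y = Re (Ci * l)%C).
{ apply is_derive_unique.
  exact (is_derive_line f _ l _ Re _ y Hf HRe re_le_Cmod Cmod_Ci Hv). }
assert (E4 : partial_y v x y = Im (Ci * l)%C).
{ apply is_derive_unique.
  exact (is_derive_line f _ l _ Im _ y Hf HIm im_le_Cmod Cmod_Ci Hv). }
rewrite E1, E2, E3, E4; simpl; split; ring.
Qed.

Lemma locally_2d_of_open (Omega P : C -> Prop) (z : C) :
  @locally C_UniformSpace z Omega -> (forall w, Omega w -> P w) ->
  locally_2d (fun x y => P (x, y)) (Re z) (Im z).
Proof.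
intros Hz HP. destruct z as [x y]. apply locally_2d_locally.
revert Hz; apply filter_imp; intros [a b] Hw; now apply HP.
Qed.

(** Since the Cauchy-Riemann equations hold on an open set, they may be
    differentiated once more; symmetry of the mixed partials does the rest. *)
Lemma holomorphic_harmonic (Omega : C -> Prop) (f : C -> C) :
  (forall z, Omega z -> @locally C_UniformSpace z Omega) ->
  holomorphic_on Omega f ->
  (forall z, Omega z -> ex_diff_n (of_xy (fun w => Re (f w))) 2 (Re z) (Im z)) ->
  (forall z, Omega z -> ex_diff_n (of_xy (fun w => Im (f w))) 2 (Re z) (Im z)) ->
  harmonic_on Omega f.
Proof.
intros Hopen Hol HRe HIm.
set (u := of_xy (fun z => Re (f z))) in *.
set (v := of_xy (fun z => Im (f z))) in *.
assert (HCR : forall z, Omega z -> locally_2d (fun x y =>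
  partial_x u x y = partial_y v x y /\ partial_y u x y = - partial_x v x y) (Re z) (Im z)).
{ intros z Hz. apply (locally_2d_of_open Omega
    (fun w => partial_x u (fst w) (snd w) = partial_y v (fst w) (snd w) /\
              partial_y u (fst w) (snd w) = - partial_x v (fst w) (snd w)) z (Hopen z Hz)).
  intros [x y] Hw; destruct (Hol _ Hw) as [l Hl]; exact (cauchy_riemann f x y l Hl). }
assert (HCR' : forall z, Omega z ->
  partial_x (partial_x u) (Re z) (Im z) = partial_x (partial_y v) (Re z) (Im z) /\
  partial_y (partial_y u) (Re z) (Im z) = - partial_y (partial_x v) (Re z) (Im z) /\
  partial_x (partial_y u) (Re z) (Im z) = - partial_x (partial_x v) (Re z) (Im z) /\
  partial_y (partial_x u) (Re z) (Im z) = partial_y (partial_y v) (Re z) (Im z)).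
{ intros z Hz. specialize (HCR z Hz).
  assert (Hx := locally_2d_1d_const_y _ _ _ HCR).
  assert (Hy := locally_2d_1d_const_x _ _ _ HCR).
  repeat split.
  - apply Derive_ext_loc; revert Hx; apply filter_imp; tauto.
  - unfold partial_y at 3; rewrite <- Derive_opp.
    apply Derive_ext_loc; revert Hy; apply filter_imp; tauto.
  - unfold partial_x at 2; rewrite <- Derive_opp.
    apply Derive_ext_loc; revert Hx; apply filter_imp; tauto.
  - apply Derive_ext_loc; revert Hy; apply filter_imp; tauto. }
split; intros z Hz; (split; [now auto|]); destruct (HCR' z Hz) as [H1 [H2 [H3 H4]]].
- change (partial_x (partial_x u) (Re z) (Im z) + partial_y (partial_y u) (Re z) (Im z) = 0).
  rewrite H1, H2, partial_x_y_comm; [ring|].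
  now apply (locally_2d_of_open Omega (fun w => ex_diff_n v 2 (Re w) (Im w)) z (Hopen z Hz)).
- change (partial_x (partial_x v) (Re z) (Im z) + partial_y (partial_y v) (Re z) (Im z) = 0).
  replace (partial_x (partial_x v) (Re z) (Im z)) with (- partial_x (partial_y u) (Re z) (Im z)) by lra.
  rewrite <- H4, partial_x_y_comm; [ring|].
  now apply (locally_2d_of_open Omega (fun w => ex_diff_n u 2 (Re w) (Im w)) z (Hopen z Hz)).
Qed.

(** Harmonicity is stated with the total operator [Derive], so the first partial
    derivatives have to be known to exist along a segment of each coordinate line:
    this comes from harmonicity at the neighbouring points. *)
Lemma is_laplacian_of_harmonic (Omega : C -> Prop) (f : C -> R) (z : C) :
  @locally C_UniformSpace z Omega -> harmonic_on_R Omega f -> Omega z ->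
  is_laplacian f z 0.
Proof.
intros Hopen Hf Hz.
destruct (Hf z Hz) as [[_ [_ [_ [[_ [H1 _]] [_ [_ [H2 _]]]]]]] H0].
exists (partial_x (partial_x (of_xy f)) (Re z) (Im z)), (partial_y (partial_y (of_xy f)) (Re z) (Im z)).
split; [|split].
- exists (fun t => partial_x (of_xy f) t (Im z)); split; [|now apply Derive_correct].
  apply (locally_line_x z Omega) in Hopen; revert Hopen; apply filter_imp.
  intros t Ht; destruct (Hf _ Ht) as [[_ [H _]] _]. now apply Derive_correct.
- exists (fun t => partial_y (of_xy f) (Re z) t); split; [|now apply Derive_correct].
  apply (locally_line_y z Omega) in Hopen; revert Hopen; apply filter_imp.
  intros t Ht; destruct (Hf _ Ht) as [[_ [_ [H _]]] _]. now apply Derive_correct.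
- exact H0.
Qed.

(** * The reflected exterior part *)

(** Real-valued version of [reflect], applied to the real and the imaginary part
    separately. *)
Definition reflect_R (H : C -> R) (z : C) : R :=
  if Ceq_dec z 0 then 0 else H (inversion z).

(** At 0, continuity with the value 0 is the vanishing of [H] at infinity; away
    from 0 the inversion maps the closed disc to the closed exterior. *)
Lemma continuous_on_reflect_R (H : C -> R) :
  @continuous_on C_UniformSpace R_UniformSpace closed_exterior H ->
  (forall eps, 0 < eps -> exists M, forall z, M < Cmod z -> Rabs (H z) < eps) ->
  @continuous_on C_UniformSpace R_UniformSpace closed_disc (reflect_R H).
Proof.
intros Hc Hinf z Hz.
destruct (Ceq_dec z 0) as [->|Hz0].
- apply (filterlim_locally (U := R_UniformSpace)).
  intros eps. destruct (Hinf eps (cond_pos eps)) as [M HM].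
  set (M' := Rmax M 1).
  assert (HM' : 0 < / M').
  { apply Rinv_0_lt_compat. generalize (Rmax_r M 1); unfold M'; lra. }
  assert (H0 : Cmod 0 < / M') by now rewrite Cmod_0.
  apply filter_le_within. generalize (locally_Cmod_lt _ _ H0).
  apply filter_imp; intros w Hw.
  unfold reflect_R. destruct (Ceq_dec 0 0) as [_|n]; [|now elim n].
  destruct (Ceq_dec w 0) as [_|n]; [apply ball_center|].
  change (Rabs (H (inversion w) - 0) < eps). rewrite Rminus_0_r. apply HM.
  rewrite (Cmod_inversion w n). apply Cmod_gt_0 in n.
  apply Rle_lt_trans with (/ / M'); [rewrite Rinv_inv; apply Rmax_l|].
  apply Rinv_0_lt_contravar; lra.
- unfold reflect_R at 2. destruct (Ceq_dec z 0) as [e|_]; [easy|].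
  assert (Hext : forall w : C, w <> 0%C -> H (inversion w) = reflect_R H w).
  { intros w Hw; unfold reflect_R; now destruct (Ceq_dec w 0). }
  intros P HP.
  assert (Hw : forall w : C, w <> 0%C -> closed_disc w -> closed_exterior (inversion w)).
  { intros w Hw Hw1; unfold closed_exterior; rewrite Cmod_inversion by exact Hw.
    rewrite <- Rinv_1; apply Rinv_le_contravar; [now apply Cmod_gt_0|exact Hw1]. }
  assert (HQ : locally z (fun w => closed_exterior (inversion w) -> P (H (inversion w))))
    by exact (continuous_inversion z Hz0 _ (Hc _ (Hw z Hz0 Hz) P HP)).
  change (locally z (fun w => closed_disc w -> P (reflect_R H w))).
  generalize (filter_and _ _ HQ (locally_neq_0 z Hz0)).
  apply filter_imp; intros w [H1 H2] H3.
  rewrite <- Hext by exact H2. apply H1. now apply Hw.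
Qed.

(** * The representation of the Dirichlet solution *)

Lemma dirichlet_representation_R (U h H : C -> R) :
  @continuous_on C_UniformSpace R_UniformSpace closed_disc U ->
  harmonic_on_R open_disc U ->
  @continuous_on C_UniformSpace R_UniformSpace closed_disc h ->
  harmonic_on_R open_disc h ->
  @continuous_on C_UniformSpace R_UniformSpace closed_exterior H ->
  harmonic_on_R open_exterior H ->
  (forall z, open_exterior z -> ex_diff_n (of_xy H) 3 (Re z) (Im z)) ->
  (forall eps, 0 < eps -> exists M, forall z, M < Cmod z -> Rabs (H z) < eps) ->
  (forall z, unit_circle z -> U z = h z + H z) ->
  forall z, open_disc z -> U z = h z + reflect_R H z.
Proof.
intros HUc HUh Hhc Hhh HHc HHh HHd HHinf Hbd z Hz.
assert (HW : U z + -1 * h z + -1 * reflect_R H z = 0); [|lra].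
apply (zero_of_harmonic_punctured (fun w => U w + -1 * h w + -1 * reflect_R H w)).
- apply continuous_on_lin; [now apply continuous_on_lin|].
  now apply continuous_on_reflect_R.
- intros w Hw Hw0. replace 0 with (0 + -1 * 0 + -1 * 0) by ring.
  assert (Ho := locally_open_disc w Hw).
  apply is_laplacian_lin; [apply is_laplacian_lin|].
  + now apply is_laplacian_of_harmonic with open_disc.
  + now apply is_laplacian_of_harmonic with open_disc.
  + assert (Hext : open_exterior (inversion w)).
    { unfold open_exterior; rewrite Cmod_inversion by exact Hw0.
      rewrite <- Rinv_1; apply Rinv_0_lt_contravar; [now apply Cmod_gt_0|exact Hw]. }
    apply is_laplacian_ext with (fun v => H (inversion v)).
    { generalize (locally_neq_0 w Hw0); apply filter_imp; intros v Hv.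
      unfold reflect_R; now destruct (Ceq_dec v 0). }
    apply is_laplacian_inversion; [exact Hw0| |now apply HHh].
    exact (locally_2d_of_open open_exterior (fun v => ex_diff_n (of_xy H) 3 (Re v) (Im v))
      _ (locally_open_exterior _ Hext) HHd).
- intros w Hw; unfold reflect_R. rewrite (Hbd w Hw), (inversion_unit w Hw).
  destruct (Ceq_dec w 0) as [->|_]; [|ring].
  unfold unit_circle in Hw; rewrite Cmod_0 in Hw; lra.
- exact Hz.
Qed.

Theorem theorem4p1 (u h H U : C -> C) :
  smooth_on_circle u ->
  is_hH_decomposition u h H ->
  is_dirichlet_solution u U ->
  forall z : C, open_disc z -> U z = (h z + reflect H z)%C.
Proof.
intros _ [Hhol [[Hhc1 [Hhd1 _]] [Hhc2 [Hhd2 _]]] HHol [[HHc1 [HHd1 _]] [HHc2 [HHd2 _]]] Hinf Hsum]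
  [HUc [HUh1 HUh2] HUb] z Hz.
destruct (holomorphic_harmonic open_disc h locally_open_disc Hhol (Hhd1 2%nat) (Hhd2 2%nat))
  as [Hhh1 Hhh2].
destruct (holomorphic_harmonic open_exterior H locally_open_exterior HHol (HHd1 2%nat) (HHd2 2%nat))
  as [HHh1 HHh2].
assert (HE1 : forall eps, 0 < eps -> exists M, forall z, M < Cmod z -> Rabs (Re (H z)) < eps).
{ intros eps Heps; destruct (Hinf eps Heps) as [M HM]; exists M; intros w Hw.
  eapply Rle_lt_trans; [apply re_le_Cmod|auto]. }
assert (HE2 : forall eps, 0 < eps -> exists M, forall z, M < Cmod z -> Rabs (Im (H z)) < eps).
{ intros eps Heps; destruct (Hinf eps Heps) as [M HM]; exists M; intros w Hw.
  eapply Rle_lt_trans; [apply im_le_Cmod|auto]. }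
assert (HUc1 : @continuous_on C_UniformSpace R_UniformSpace closed_disc (fun z => Re (U z))).
{ intros w Hw. apply filterlim_comp with (2 := continuous_Re (U w)). now apply HUc. }
assert (HUc2 : @continuous_on C_UniformSpace R_UniformSpace closed_disc (fun z => Im (U z))).
{ intros w Hw. apply filterlim_comp with (2 := continuous_Im (U w)). now apply HUc. }
apply injective_projections.
- assert (E := dirichlet_representation_R _ _ _ HUc1 HUh1 Hhc1 Hhh1 HHc1 HHh1 (HHd1 3%nat) HE1).
  simpl in E. change (fst (U z)) with (Re (U z)). rewrite E.
  + unfold reflect_R, reflect; destruct (Ceq_dec z 0); reflexivity.
  + intros w Hw; rewrite (HUb w Hw), (Hsum w Hw); reflexivity.
  + exact Hz.
- assert (E := dirichlet_representation_R _ _ _ HUc2 HUh2 Hhc2 Hhh2 HHc2 HHh2 (HHd2 3%nat) HE2).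
  simpl in E. change (snd (U z)) with (Im (U z)). rewrite E.
  + unfold reflect_R, reflect; destruct (Ceq_dec z 0); reflexivity.
  + intros w Hw; rewrite (HUb w Hw), (Hsum w Hw); reflexivity.
  + exact Hz.
Qed.
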